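(* Assume that $\tau L_f\le\frac12$, where $\tau=T/N$. Let $v^n$ and $\bar v^n$ be the solutions of $$v^n+\tau Av^n=v^{n-1}+\tau f(v^n+w^n),\quad v^0=u_0,\qquad\qquad \bar v^n+\tau A\bar v^n=\bar v^{n-1}+\tau f(\bar v^n+w_J^n),\quad \bar v^0=u_0,\qquad 1\le n\le N.$$ Then, with $C=2L_fT\mathrm e^{2L_fT}$, $$\max_{1\le n\le N}\big(\mathbb E[\|\bar v^n-v^n\|^2]\big)^{\frac12}\le C\max_{1\le n\le N}\big(\mathbb E[\|w_J^n-w^n\|^2]\big)^{\frac12}.$$
   Context: Setting. $T>0$; $\mathcal D\subset\mathbb R^d$, $d\in\{1,2,3\}$, is a convex polygonal domain or a domain with smooth boundary; $H=L_2(\mathcal D)$ with norm $\|\cdot\|$; $V=H^1_0(\mathcal D)$; $Au=-\nabla\cdot(\kappa\nabla u)$ with $\kappa$ smooth, $\kappa(x)>\kappa_0>0$, with domain $H^2(\mathcal D)\cap H^1_0(\mathcal D)$ in $H$ (self-adjoint, positive definite). $f\colon H\to H$ satisfies $\|f(u)-f(v)\|\le L_f\|u-v\|$ for all $u,v\in H$. $W$ is a $Q$-Wiener process (cylindrical if $Q$ is not trace class) with covariance operator $Q$ on $H$ such that, for some $\beta\ge0$, the Hilbert–Schmidt norm $\|A^{\frac{\beta-1}2}Q^{\frac12}\|_{\mathrm{HS}}$ is finite and $u_0\in L_2(\Omega,\dot H^\beta)$, where $\dot H^\beta=D(A^{\beta/2})$ with norm $\|A^{\beta/2}\cdot\|$.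 With $t_n=n\tau$ and $\Delta W^n=W(t_n)-W(t_{n-1})$, the sequences $w^n$ and $w_J^n$ are the square-integrable $H$-valued random variables given by $w^n+\tau Aw^n=w^{n-1}+\Delta W^n$, $w^0=0$, and $w_J^n+\tau A_Jw_J^n=w_J^{n-1}+P_J\Delta W^n$, $w_J^0=0$. Here $S_J\subset V$ is a finite-dimensional (multiresolution) space, $P_J$ is the $H$-orthogonal projector onto $S_J$ extended to $V'$ by duality, and $A_J\colon S_J\to S_J$ is defined by $(A_Jv_J,w_J)=\langle Av_J,w_J\rangle$ for $v_J,w_J\in S_J$. *)

(* Defs.v *)
From HB Require Import structures.
From mathcomp Require Import all_boot all_order all_algebra.
From mathcomp Require Import all_classical all_reals all_analysis.
From mathcomp Require Import measurable_realfun.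

Set Implicit Arguments.
Unset Strict Implicit.
Unset Printing Implicit Defensive.

Import Order.TTheory GRing.Theory Num.Theory.
Import numFieldNormedType.Exports.

Local Open Scope classical_set_scope.
Local Open Scope ring_scope.

Section euclidean_space.
Variable R : realType.

Definition borel_rV (d : nat) := g_sigma_algebraType (@open 'rV[R]_d).

Lemma measurable_tuple_row (d : nat) :
  measurable_fun [set: d.-tuple (measurableTypeR R)]
    (fun t => \row_i tnth t i : borel_rV d).
Proof.
apply: (@measurability _ _ _ (borel_rV d) _ _ (@open 'rV[R]_d)) => //.
move=> _ [U oU <-]; rewrite setTI.
set row := (X in X @^-1` _).
pose B (q : 'rV[rat]_d * nat) : set 'rV[R]_d :=
  ball (map_mx ratr q.1 : 'rV[R]_d) q.2.+1%:R^-1.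
pose F (q : 'rV[rat]_d * nat) :=
  if `[< B q `<=` U >] then row @^-1` B q else set0.
rewrite (_ : _ @^-1` _ = \bigcup_q F q).
  apply: countable_bigcupT_measurable;
    first exact: (countableP [set: 'rV[rat]_d * nat]).
  move=> q; rewrite /F; case: ifP => // _.
  rewrite (_ : _ @^-1` _ = \bigcap_(i : 'I_d)
      ((fun t : d.-tuple (measurableTypeR R) => tnth t i) @^-1`
        ball (ratr (q.1 ord0 i) : R) q.2.+1%:R^-1)).
    apply: fin_bigcap_measurable => [|i _]; first exact: finite_finset.
    rewrite -[X in measurable X]setTI; apply: measurable_tnth => //.
    exact: (@open_measurable R _ (ball_open _ _)).
  apply/seteqP; split=> t /=.
    by move=> [_ h] i _ /=; have := h ord0 i; rewrite !mxE.
  move=> h; split => [|i j]; first by rewrite invr_gt0.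
  by rewrite ord1 !mxE; exact: (h j I).
apply/seteqP; split=> t /=; last first.
  by move=> [q _]; rewrite /F; case: asboolP => // BU /BU.
move=> Ut.
have /nbhs_ballP[e /= e0 eU] := open_nbhs_nbhs (conj oU Ut).
have [n ne] : exists n, 0 + n.+1%:R^-1 < e / 2 :> R.
  by apply: ltr_add_invr; rewrite divr_gt0.
rewrite add0r in ne.
have n0 : 0 < n.+1%:R^-1 :> R by rewrite invr_gt0.
have /choice[q qP] (i : 'I_d) :
    exists q : rat, ball (tnth t i : R) n.+1%:R^-1 (ratr q).
  have [r [h [q _ qx]]] :=
    dense_rat (ex_intro _ _ (ballxx (tnth t i : R) n0)) (ball_open _ _).
  by exists q; rewrite qx.
exists (\row_i q i, n) => //; rewrite /F; case: asboolP => [BU|].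
  rewrite /B; split => // i j; rewrite !mxE; apply: ball_sym.
  exact: qP.
case=> y [_ hy]; apply: eU; split=> // i j; rewrite ord1.
apply: (@le_ball _ _ _ (n.+1%:R^-1 + n.+1%:R^-1)).
  by rewrite (splitr e) lerD// ltW.
apply: (@ball_triangle _ _ (ratr (q j) : R)); first by rewrite mxE; exact: qP.
by have := hy ord0 j; rewrite !mxE.
Qed.
End euclidean_space.

Section L2_space.
Context d (T : measurableType d) (R : realType).
Variable mu : {measure set T -> \bar R}.
Local Notation Lf := (LfunType mu (lee1n 2)).

Definition ae_zero : {pred Lf} := fun f => `[< (f : T -> R) = cst 0 %[ae mu] >].

Lemma ae_zero_zmod_closed : zmod_closed ae_zero.
Proof.
split; first by apply/asboolP; apply: nearW.
move=> f g /asboolP f0 /asboolP g0; apply/asboolP.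
apply: filterS2 f0 g0 => x f0 g0 _ /=.
by rewrite -[LHS]/(f x - g x) f0// g0// subr0.
Qed.

HB.instance Definition _ :=
  GRing.isZmodClosed.Build Lf ae_zero ae_zero_zmod_closed.

(* Square-integrable functions modulo equality almost everywhere. *)
Definition L2 : Type := Quotient.quot (ae_zero : zmodClosed Lf).
HB.instance Definition _ := Choice.on L2.
HB.instance Definition _ := EqQuotient.on L2.
HB.instance Definition _ := GRing.Zmodule.on L2.

Definition L2_fun (u : L2) : T -> R := (repr u : Lf).

Local Open Scope quotient_scope.

Lemma L2_eqP (f g : Lf) :
  reflect ((f : T -> R) = g %[ae mu]) (\pi_L2 f == \pi_L2 g).
Proof.
rewrite -Quotient.idealrBE; apply: (iffP (asboolP _)).
  by apply: filterS => x /(_ I) h _; apply/eqP; rewrite -subr_eq0; apply/eqP.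
apply: filterS => x /(_ I) h _.
by rewrite -[LHS]/(f x - g x) h subrr.
Qed.

Lemma L2_funE (f : Lf) : L2_fun (\pi_L2 f) = f %[ae mu].
Proof. by apply/L2_eqP; rewrite /L2_fun reprK. Qed.

Lemma L2_fun_inj (u v : L2) : L2_fun u = L2_fun v %[ae mu] -> u = v.
Proof. by move=> /L2_eqP/eqP; rewrite !reprK. Qed.

Lemma L2_piD (f g : Lf) : \pi_L2 (f + g) = \pi_L2 f + \pi_L2 g.
Proof. exact: Quotient.pi_add. Qed.

Lemma L2_piN (f : Lf) : \pi_L2 (- f) = - \pi_L2 f.
Proof. exact: Quotient.pi_opp. Qed.

Lemma L2_pi0 : \pi_L2 (0 : Lf) = 0.
Proof. by rewrite -(subrr (0 : Lf)) L2_piD L2_piN subrr. Qed.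

Lemma L2_piMn (f : Lf) k : \pi_L2 (f *+ k) = \pi_L2 f *+ k.
Proof.
elim: k => [|k IHk]; first by rewrite !mulr0n L2_pi0.
by rewrite (mulrS f) L2_piD IHk -mulrS.
Qed.

Lemma L2_funD (u v : L2) : L2_fun (u + v) = L2_fun u \+ L2_fun v %[ae mu].
Proof.
have -> : u + v = \pi_L2 (repr u + repr v) by rewrite L2_piD !reprK.
exact: L2_funE.
Qed.

Lemma L2_funN (u : L2) : L2_fun (- u) = \- L2_fun u %[ae mu].
Proof.
have -> : - u = \pi_L2 (- repr u) by rewrite L2_piN reprK.
exact: L2_funE.
Qed.

Definition L2_scale (a : R) (u : L2) : L2 := \pi_L2 (a *: (repr u : Lf)).

Lemma L2_pi_scale (a : R) (f : Lf) : L2_scale a (\pi_L2 f) = \pi_L2 (a *: f).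
Proof.
apply/eqP/L2_eqP; have := L2_funE f.
by apply: filterS => x /(_ I) h _; rewrite -[LHS]/(a * L2_fun _ x) h.
Qed.

Lemma L2_scaleA a b u : L2_scale a (L2_scale b u) = L2_scale (a * b) u.
Proof. by rewrite {2}/L2_scale L2_pi_scale scalerA. Qed.

Lemma L2_scale1 : left_id 1 L2_scale.
Proof. by move=> u; rewrite /L2_scale scale1r reprK. Qed.

Lemma L2_scaleDr : right_distributive L2_scale +%R.
Proof.
move=> a u v; rewrite -[u]reprK -[v]reprK -L2_piD !L2_pi_scale.
by rewrite -L2_piD scalerDr.
Qed.

Lemma L2_scaleDl u : {morph L2_scale^~ u : a b / a + b}.
Proof. by move=> a b; rewrite /L2_scale -L2_piD scalerDl. Qed.

HB.instance Definition _ := GRing.Zmodule_isLmodule.Build R L2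
  L2_scaleA L2_scale1 L2_scaleDr L2_scaleDl.

Lemma L2_funZ (a : R) (u : L2) : L2_fun (a *: u) = a \*: L2_fun u %[ae mu].
Proof. exact: L2_funE. Qed.

Definition L2_norm (u : L2) : R := fine ('N[mu]_2[EFin \o L2_fun u]).

Lemma ae_eq_Lnorm2 (f g : Lf) : (f : T -> R) = g %[ae mu] ->
  'N[mu]_2[EFin \o (f : T -> R)]%E = 'N[mu]_2[EFin \o (g : T -> R)]%E.
Proof.
move=> fg; rewrite unlock; congr (_ `^ _)%E; apply: ge0_ae_eq_integral => //.
- apply: (measurableT_comp (measurable_poweR 2)).
  by apply: measurableT_comp => //; apply/measurable_EFinP.
- apply: (measurableT_comp (measurable_poweR 2)).
  by apply: measurableT_comp => //; apply/measurable_EFinP.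
- by move=> x _; exact: poweR_ge0.
- by move=> x _; exact: poweR_ge0.
by apply: filterS fg => x /(_ I) h _ /=; rewrite h.
Qed.

Lemma L2_norm_pi (f : Lf) :
  L2_norm (\pi_L2 f) = fine ('N[mu]_2[EFin \o (f : T -> R)]).
Proof. by congr fine; apply: ae_eq_Lnorm2; exact: L2_funE. Qed.

Lemma L2_normD (u v : L2) : L2_norm (u + v) <= L2_norm u + L2_norm v.
Proof.
by rewrite -[u]reprK -[v]reprK -L2_piD !L2_norm_pi; exact: ler_LnormD.
Qed.

Lemma L2_norm_eq0 (u : L2) : L2_norm u = 0 -> u = 0.
Proof.
move=> /fine_Lnormr_eq0 u0; apply: L2_fun_inj; rewrite -L2_pi0.
by apply: filterS2 u0 (L2_funE 0) => x /(_ I) ux /(_ I) -> _; exact: ux.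
Qed.

Lemma L2_normMn (u : L2) k : L2_norm (u *+ k) = L2_norm u *+ k.
Proof.
rewrite -[u]reprK -L2_piMn.
by rewrite !L2_norm_pi; exact: Lnormr_natmul.
Qed.

Lemma L2_normN (u : L2) : L2_norm (- u) = L2_norm u.
Proof. by rewrite -[u]reprK -L2_piN !L2_norm_pi; exact: LnormrN. Qed.

HB.instance Definition _ := Num.Zmodule_isNormed.Build R L2
  L2_normD L2_norm_eq0 L2_normMn L2_normN.

Definition L2_dot (u v : L2) : R := \int[mu]_x (L2_fun u x * L2_fun v x).
End L2_space.

Section lebesgue_measure_rV.
Variable R : realType.

Definition measure_pushforward d1 d2 (T1 : measurableType d1)
    (T2 : measurableType d2) (m : {measure set T1 -> \bar R}) (f : T1 -> T2)
    (mf : measurable_fun [set: T1] f) : {measure set T2 -> \bar R} :=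
  measure_function_pushforward__canonical__measure_function_Measure m mf.

Definition tuple_snoc (d : nat)
    (p : d.-tuple (measurableTypeR R) * measurableTypeR R) :
  d.+1.-tuple (measurableTypeR R) := [tuple of p.2 :: p.1].

Lemma measurable_tuple_snoc d : measurable_fun [set: _] (@tuple_snoc d).
Proof. exact: (measurable_cons measurable_snd measurable_fst). Qed.

Fixpoint lebesgue_tuple (d : nat) :
    {measure set (d.-tuple (measurableTypeR R)) -> \bar R} :=
  match d with
  | 0 => dirac [tuple]
  | k.+1 => measure_pushforward (lebesgue_tuple k \x lebesgue_measure)%E
              (@measurable_tuple_snoc k)
  end.

Definition lebesgue_rV (d : nat) : {measure set (borel_rV R d) -> \bar R} :=
  measure_pushforward (lebesgue_tuple d) (@measurable_tuple_row R d).

End lebesgue_measure_rV.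

Section domains.
Variables (R : realType) (d : nat).
Implicit Types (U : set 'rV[R]_d) (g : 'rV[R]_d -> R).

Definition partial (i : 'I_d) g : 'rV[R]_d -> R :=
  fun x => 'D_(delta_mx 0 i) g x.

(* C^oo on an open set U: all iterated partial derivatives exist and are
   continuous on U. *)
Definition smooth_on U g := forall (s : seq 'I_d) x, U x ->
  {for x, continuous (foldr partial g s)} /\
  forall i, derivable (foldr partial g s) x (delta_mx 0 i).

(* The interior of a convex polytope (the bound comes from [domain] below). *)
Definition convex_polytope U := exists (m : nat) (a : 'I_m -> 'rV[R]_d)
    (b : 'I_m -> R),
  U = [set x | forall i, \sum_k a i 0 k * x 0 k < b i].

(* Near each boundary point, U is the negative side of a smooth function with
   non-vanishing gradient. *)
Definition smooth_boundary U := forall x, (closure U `\` U) x ->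
  exists (B : set 'rV[R]_d) rho, [/\ open B, B x, smooth_on B rho,
    forall y, B y -> exists i, partial i rho y != 0 &
    U `&` B = [set y | B y /\ rho y < 0]].

Record domain := Domain {
  dom_set :> set 'rV[R]_d;
  dom_open : open dom_set;
  dom_connected : connected dom_set;
  dom_neq0 : dom_set !=set0;
  dom_bounded : bounded_set dom_set;
  dom_shape : convex_polytope dom_set \/ smooth_boundary dom_set }.

Lemma measurable_domain (D : domain) :
  measurable (dom_set D : set (borel_rV R d)).
Proof. by apply: sub_sigma_algebra; exact: dom_open. Qed.

Definition dom_measure (D : domain) : {measure set (borel_rV R d) -> \bar R} :=
  mrestr (lebesgue_rV R d) (measurable_domain D).

(* C_c^oo(D), the functions being extended by 0 outside D. *)
Definition test_function (D : domain) g := smooth_on setT g /\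
  exists K, [/\ compact K, K `<=` D & forall x, ~ K x -> g x = 0].

End domains.

(* L_2(D): [dom_measure D] vanishes outside D, so the values there are
   irrelevant. *)
Notation L2D D := (L2 (dom_measure D)).

Section sobolev.
Variables (R : realType) (d : nat) (D : domain R d).
Local Notation mu := (dom_measure D).
Local Notation H := (L2D D).
Implicit Types u v g : H.

Definition is_weak_partial (i : 'I_d) u g := forall psi, test_function D psi ->
  \int[mu]_x (L2_fun u x * partial i psi x) =
  - \int[mu]_x (L2_fun g x * psi x).

(* The i-th weak derivative; 0 if there is none in L_2(D). *)
Definition weak_partial (i : 'I_d) u : H :=
  xget 0 [set g | is_weak_partial i u g].

Definition H1 : set H := [set u | forall i, exists g, is_weak_partial i u g].

Definition H2 : set H := [set u | H1 u /\ forall i, H1 (weak_partial i u)].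

(* The closure of C_c^oo(D) in H^1(D). *)
Definition H10 : set H := [set u | H1 u /\ forall eps : R, 0 < eps ->
  exists psi, [/\ test_function D psi,
    ('N[mu]_2[EFin \o (L2_fun u \- psi)%R] < eps%:E)%E &
    forall i, ('N[mu]_2[EFin \o
      (L2_fun (weak_partial i u) \- partial i psi)%R] < eps%:E)%E]].

Definition H1_norm u : R :=
  Num.sqrt (`|u| ^+ 2 + \sum_i `|weak_partial i u| ^+ 2).

(* Elements of V' = H^{-1}(D), as functions on H of which only the values on
   V = H^1_0(D) matter. *)
Definition dual_H10 (l : H -> R) :=
  (forall a u v, H10 u -> H10 v -> l (a *: u + v) = a * l u + l v) /\
  exists C, forall u, H10 u -> `|l u| <= C * H1_norm u.

Variable kappa : 'rV[R]_d -> R.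

(* The extension V -> V' of A. *)
Definition dual_A u : H -> R := fun v =>
  \int[mu]_(x in dom_set D) (kappa x *
    \sum_i L2_fun (weak_partial i u) x * L2_fun (weak_partial i v) x).

(* The graph of A: u is in H^2(D) and H^1_0(D), and
   g = - div (kappa grad u) in the sense of distributions. *)
Definition op_A u g := [/\ H2 u, H10 u & forall psi, test_function D psi ->
  \int[mu]_x (L2_fun g x * psi x) =
  \int[mu]_(x in dom_set D) (kappa x *
    \sum_i L2_fun (weak_partial i u) x * partial i psi x)].

Definition orthonormal_basis (e : nat -> H) :=
  (forall j k, L2_dot (e j) (e k) = (j == k)%:R) /\
  (forall u, (forall j, L2_dot u (e j) = 0) -> u = 0).

(* The graph of A^s, by expansion in an eigenbasis of A. *)
Definition op_A_power (s : R) u g := exists (lam : nat -> R) (e : nat -> H),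
  [/\ orthonormal_basis e,
      forall j, 0 < lam j /\ op_A (e j) (lam j *: e j) &
      forall j, L2_dot g (e j) = lam j `^ s * L2_dot u (e j)].

Definition finite_HS_norm (B : H -> H) := exists e, orthonormal_basis e /\
  (\sum_(0 <= k <oo) (`|B (e k)| ^+ 2)%:E < +oo)%E.

Definition psd_operator (Q : {linear H -> H}) :=
  [/\ exists C, forall u, `|Q u| <= C * `|u|,
      forall u v, L2_dot (Q u) v = L2_dot u (Q v) &
      forall u, 0 <= L2_dot (Q u) u].

Definition psd_sqrt (Q Qh : {linear H -> H}) :=
  psd_operator Qh /\ forall u, Qh (Qh u) = Q u.

(* P_J : V' -> S_J for S = S_J. *)
Definition dual_proj (S : set H) (l : H -> R) : H :=
  xget 0 [set p | S p /\ forall v, S v -> L2_dot p v = l v].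

(* A_J: (A_J u, v) = <A u, v> for all v in S. *)
Definition discrete_A (S : set H) u : H := dual_proj S (dual_A u).

Definition span_set (m : nat) (b : 'I_m -> H) : set H :=
  [set u | exists c : 'I_m -> R, u = \sum_i c i *: b i].

End sobolev.

Section random_variables.
Context {R : realType} {d : nat} {D : domain R d}.
Context {dOm : measure_display} {Om : measurableType dOm}.
Variable P : probability Om R.
Local Notation mu := (dom_measure D).
Local Notation H := (L2D D).

Definition simple_rv (X : Om -> H) :=
  finite_set (range X) /\ forall h, measurable (X @^-1` [set h]).

Definition strongly_measurable (X : Om -> H) := exists S : nat -> Om -> H,
  (forall k, simple_rv (S k)) /\
  forall om, `|S k om - X om| @[k --> \oo] --> (0 : R).

(* (E ||X||^2)^(1/2) *)
Definition rms (X : Om -> H) : \bar R := sqrte 'E_P[fun om => `|X om| ^+ 2].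

(* L_2(Omega, H) *)
Definition square_integrable (X : Om -> H) :=
  strongly_measurable X /\ (rms X < +oo)%E.

(* L_2(Omega, D(A^(beta/2))) *)
Definition square_integrable_dotH (kappa : 'rV[R]_d -> R) (beta : R)
    (X : Om -> H) :=
  strongly_measurable X /\ exists Y, square_integrable Y /\
  {ae P, forall om, op_A_power kappa (beta / 2) (X om) (Y om)}.

Definition centered_gaussian (X : Om -> R) (v : R) :=
  (v = 0 /\ {ae P, forall om, X om = 0}) \/
  (0 < v /\ forall B : set (measurableTypeR R), measurable B ->
     P (X @^-1` B) = normal_prob 0 (Num.sqrt v) B).

(* The sigma-algebra generated by a V'-valued map. *)
Definition sigma_dual (X : Om -> H -> R) : set (set Om) :=
  <<s [set E | exists phi (B : set (measurableTypeR R)),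
    [/\ H10 phi, measurable B & E = (fun om => X om phi) @^-1` B]] >>.

Definition increment (W : R -> Om -> H -> R) (s t : R) : Om -> H -> R :=
  fun om phi => W t om phi - W s om phi.

(* The Q-Wiener process on [0, T]. If Q is not of trace class it is not
   H-valued; finiteness of the Hilbert-Schmidt norm of A^((beta - 1)/2) Q^(1/2)
   with beta >= 0 places it in V', so it is modelled as a V'-valued process. *)
Record wiener (T : R) (Q : {linear H -> H}) (W : R -> Om -> H -> R) : Prop := {
  wiener_dual : forall (t : R) om, 0 <= t <= T -> dual_H10 (W t om);
  wiener_measurable : forall (t : R) phi, 0 <= t <= T -> H10 phi ->
    measurable_fun setT (fun om => W t om phi);
  wiener_0 : {ae P, forall om phi, H10 phi -> W 0 om phi = 0};
  wiener_continuous : {ae P, forall om, forall s : R, 0 <= s <= T ->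
    forall eps : R, 0 < eps -> exists2 delta : R, 0 < delta &
    forall t : R, 0 <= t <= T -> `|t - s| < delta ->
    forall phi, H10 phi -> `|increment W s t om phi| <= eps * H1_norm phi};
  wiener_gaussian : forall (s t : R) phi, 0 <= s -> s < t -> t <= T ->
    H10 phi ->
    centered_gaussian (fun om => increment W s t om phi)
      ((t - s) * L2_dot (Q phi) phi);
  wiener_independent : forall (m : nat) (t : nat -> R) (E : 'I_m -> set Om),
    0 <= t 0 -> t m <= T -> (forall i : nat, (i < m)%N -> t i < t i.+1) ->
    (forall i : 'I_m, sigma_dual (increment W (t i) (t i.+1)) (E i)) ->
    P (\bigcap_i E i) = (\prod_(i < m) P (E i))%E }.

End random_variables.

(* Main.v *)
(* For e^n = vbar^n - v^n, pairing the difference of the two implicit schemes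
   with e^n and dropping (A e^n, e^n) >= 0 gives, with x = tau Lf <= 1/2,
     |e^n| <= |e^(n-1)| + x (|e^n| + |w_J^n - w^n|)
   almost surely. As 1/(1 - x) <= exp(2x), this iterates to
     |e^n| <= x exp(2xn) sum_(j <= n) |w_J^j - w^j|,
   and Minkowski's inequality in L_2(Omega) concludes. *)

Require Import Defs.
From mathcomp Require Import all_boot all_order all_algebra.
From mathcomp Require Import all_classical all_reals all_analysis.
From mathcomp Require Import measurable_realfun.
From mathcomp Require Import ring lra.

Set Implicit Arguments.
Unset Strict Implicit.
Unset Printing Implicit Defensive.

Import Order.TTheory GRing.Theory Num.Theory.
Import numFieldNormedType.Exports.

Local Open Scope classical_set_scope.
Local Open Scope ring_scope.

(** * Inner product, approximation and bounded multipliers in [L2] *)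

Section L2_inner_product.
Context d (T : measurableType d) (R : realType).
Variable mu : {measure set T -> \bar R}.
Local Notation Lf := (LfunType mu (lee1n 2)).
Local Notation H := (L2 mu).
Local Open Scope quotient_scope.

Lemma measurable_L2_fun (u : H) : measurable_fun setT (L2_fun u).
Proof. exact: measurable_funPT. Qed.

Lemma L2_fun_Lfun (u : H) : L2_fun u \in Lfun mu 2%:E.
Proof. exact: (LfunP (repr u : Lf)). Qed.

Lemma Lnorm2E (f : T -> R) :
  'N[mu]_2[EFin \o f]%E = sqrte (\int[mu]_x (f x ^+ 2)%:E)%E.
Proof.
rewrite unlock -poweR12_sqrt; last first.
  by apply: integral_ge0 => x _; rewrite lee_fin sqr_ge0.
congr (_ `^ _)%E; apply: eq_integral => x _.
by rewrite /= powR_mulrn// real_normK ?num_real.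
Qed.

Lemma L2_norm_fun (u : H) : `|u|%:E = ('N[mu]_2[EFin \o L2_fun u])%E.
Proof. exact: (finite_norm_fine (repr u : Lf)). Qed.

Lemma L2_funB (u v : H) : L2_fun (u - v) = L2_fun u \- L2_fun v %[ae mu].
Proof.
apply: filterS2 (L2_funD u (- v)) (L2_funN v) => x /(_ I) /= + /(_ I) /= vx _.
by rewrite vx.
Qed.

Lemma L2_fun_surj (f : T -> R) : f \in Lfun mu 2%:E ->
  exists u : H, L2_fun u = f %[ae mu].
Proof.
by move=> fP; exists (\pi_(H) (Lfun_Sub (lee1n 2) fP : Lf)); exact: L2_funE.
Qed.

Lemma integrable_L2_mul (u v : H) :
  mu.-integrable setT (EFin \o (L2_fun u \* L2_fun v)).
Proof. by apply/Lfun1_integrable/Lfun2_mul_Lfun1; exact: L2_fun_Lfun. Qed.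

Lemma ae_eq_Rintegral (f g : T -> R) : measurable_fun setT f ->
  measurable_fun setT g -> f = g %[ae mu] -> \int[mu]_x f x = \int[mu]_x g x.
Proof.
move=> mf mg fg; congr fine; apply: ae_eq_integral => //.
- exact/measurable_EFinP.
- exact/measurable_EFinP.
by apply: filterS fg => x /(_ I) h _; rewrite h.
Qed.

(** [L2_fun] returns an arbitrary representative. This frees the inner product from that choice,
    since changes on a null set do not affect the integral. *)
Lemma L2_dotE (u v : H) (f g : T -> R) : measurable_fun setT f ->
  measurable_fun setT g -> L2_fun u = f %[ae mu] -> L2_fun v = g %[ae mu] ->
  L2_dot u v = \int[mu]_x (f x * g x).
Proof.
move=> mf mg uf vg; apply: ae_eq_Rintegral.
- by apply: measurable_funM; exact: measurable_L2_fun.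
- exact: measurable_funM.
by apply: filterS2 uf vg => x /(_ I) -> /(_ I) ->.
Qed.

Lemma L2_dotC (u v : H) : L2_dot u v = L2_dot v u.
Proof. by rewrite /L2_dot; under eq_Rintegral do rewrite mulrC. Qed.

Lemma L2_dotDl (u v w : H) : L2_dot (u + v) w = L2_dot u w + L2_dot v w.
Proof.
rewrite (@L2_dotE _ w (L2_fun u \+ L2_fun v) (L2_fun w)) //.
- under eq_Rintegral do rewrite /= mulrDl.
  by rewrite RintegralD//; exact: integrable_L2_mul.
- exact: L2_funD.
- exact: nearW.
Qed.

Lemma L2_dotZl a (u w : H) : L2_dot (a *: u) w = a * L2_dot u w.
Proof.
rewrite (@L2_dotE _ w (a \*: L2_fun u) (L2_fun w)) //.
- under eq_Rintegral do rewrite /= -mulrA.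
  by rewrite RintegralZl//; exact: integrable_L2_mul.
- by apply: measurable_funM => //; exact: measurable_L2_fun.
- exact: L2_funZ.
- exact: nearW.
Qed.

Lemma L2_dotBl (u v w : H) : L2_dot (u - v) w = L2_dot u w - L2_dot v w.
Proof. by rewrite L2_dotDl -scaleN1r L2_dotZl mulN1r. Qed.

Lemma L2_dotBr (u v w : H) : L2_dot u (v - w) = L2_dot u v - L2_dot u w.
Proof. by rewrite !(L2_dotC u) L2_dotBl. Qed.

Lemma L2_dotuu (u : H) : L2_dot u u = `|u| ^+ 2.
Proof.
apply: EFin_inj; rewrite EFin_expe L2_norm_fun Lnorm2E sqr_sqrte; last first.
  by apply: integral_ge0 => x _; rewrite lee_fin sqr_ge0.
rewrite /L2_dot /Rintegral fineK//.
by apply: integrable_fin_num => //; exact: integrable_L2_mul.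
Qed.

(** Hölder's inequality with both exponents equal to 2. *)
Lemma L2_dot_le (u v : H) : `|L2_dot u v| <= `|u| * `|v|.
Proof.
apply: (le_trans (le_normr_Rintegral _ (integrable_L2_mul u v))) => //.
rewrite -lee_fin EFinM !L2_norm_fun.
apply: le_trans (hoelder _ (measurable_L2_fun u) (measurable_L2_fun v) _ _ _);
  rewrite ?ltr0n//; last by rewrite [RHS]splitr !div1r.
rewrite Lnorm1 fineK//.
have /integrable_abse := integrable_L2_mul u v.
by move/(integrable_fin_num measurableT).
Qed.

Lemma sum_L2_dot (I : finType) (u v : I -> H) :
  \sum_i L2_dot (u i) (v i) =
  \int[mu]_x \sum_i (L2_fun (u i) x * L2_fun (v i) x).
Proof.
rewrite /Rintegral; under eq_integral do rewrite -sumEFin.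
rewrite integral_sum//; last by move=> i; exact: integrable_L2_mul.
rewrite -sum_fine// => i _.
by apply: integrable_fin_num => //; exact: integrable_L2_mul.
Qed.

(** Membership in [H10] is phrased with bare test functions; this turns them into elements of [L2].
    As [u - f] has finite norm, it has a class [r], and [u - r] is the class of [f]. *)
Lemma L2_approx (u : H) (f : T -> R) (eps : R) : measurable_fun setT f ->
  ('N[mu]_2[EFin \o (L2_fun u \- f)%R] < eps%:E)%E ->
  exists2 p : H, L2_fun p = f %[ae mu] & `|u - p| < eps.
Proof.
move=> mf ufe.
have hP : (L2_fun u \- f) \in Lfun mu 2%:E.
  rewrite inE; apply/andP; split; rewrite inE/=.
    by apply: measurable_funB => //; exact: measurable_L2_fun.
  exact: lt_trans ufe (ltry _).
pose r : H := \pi_(H) (Lfun_Sub (lee1n 2) hP : Lf).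
have rE : L2_fun r = L2_fun u \- f %[ae mu] by exact: L2_funE.
exists (u - r).
  apply: filterS2 rE (L2_funB u r) => x /(_ I) /= rx /(_ I) /= -> _.
  by rewrite rx subKr.
rewrite subKr -lte_fin L2_norm_fun.
by rewrite (@ae_eq_Lnorm2 _ _ _ mu (repr r) (Lfun_Sub (lee1n 2) hP)).
Qed.

(** Serves to make the flux components, [kappa] times [weak_partial i u], elements of [H]. Square
    integrability follows by comparison with [M] times [u]. *)
Lemma L2_mul_bounded (c : T -> R) (M : R) (u : H) : measurable_fun setT c ->
  (forall x, `|c x| <= M) ->
  exists v : H, L2_fun v = (fun x => c x * L2_fun u x) %[ae mu].
Proof.
move=> mc cM; apply: L2_fun_surj; rewrite inE; apply/andP; split; rewrite inE/=.
  by apply: measurable_funM => //; exact: measurable_L2_fun.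
have : M \o* L2_fun u \in Lfun mu 2%:E.
  by apply: Lfun_scale; [rewrite ler1n|exact: L2_fun_Lfun].
rewrite inE => /andP[_]; rewrite inE/= /finite_norm !Lnorm2E.
apply: le_lt_trans; rewrite lee_sqrt; last first.
  by apply: integral_ge0 => x _; rewrite lee_fin sqr_ge0.
apply: ge0_le_integral => //.
- by move=> x _; rewrite lee_fin sqr_ge0.
- apply/measurable_EFinP; apply: measurable_funX.
  by apply: measurable_funM => //; exact: measurable_L2_fun.
- apply/measurable_EFinP; apply: measurable_funX.
  by apply: measurable_funM => //; exact: measurable_L2_fun.
move=> x _; rewrite lee_fin /= mulrC !exprMn ler_wpM2l ?sqr_ge0//.
by rewrite -real_normK ?num_real// lerXn2r ?nnegrE ?(le_trans _ (cM x)).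
Qed.

End L2_inner_product.

(** * Measurability and boundedness of continuous and smooth functions *)

Section continuous_functions.
Context (R : realType) (d : nat).
Implicit Types (D : domain R d) (U : set 'rV[R]_d) (g : 'rV[R]_d -> R).

(** Open intervals generate the Borel sets of the line, and their preimages within [U] are open. *)
Lemma measurable_fun_open_continuous U g : open U ->
  {in U, continuous g} -> measurable_fun (U : set (borel_rV R d)) g.
Proof.
move=> oU cg; apply: (measurability _ (RGenOpens.measurableE R)).
move=> _ [_ [a [b ->] <-]].
apply: sub_sigma_algebra; rewrite openE => x [Ux gx].
apply: filterI; first exact: open_nbhs_nbhs.
apply: (cg x); first exact: mem_set.
exact: open_nbhs_nbhs (conj (interval_open _ _) gx).
Qed.

Lemma smooth_on_continuous U g (s : seq 'I_d) : smooth_on U g ->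
  {in U, continuous (foldr (@partial R d) g s)}.
Proof. by move=> sg x /set_mem /(sg s)[]. Qed.

(** The closure of a bounded set is compact in finite dimension, so its image under a continuous
    function is bounded. *)
Lemma smooth_on_bounded D g U : open U -> closure D `<=` U -> smooth_on U g ->
  exists M, forall x, dom_set D x -> `|g x| <= M.
Proof.
move=> oU DU /(@smooth_on_continuous _ _ [::]) cg.
have cD : compact (closure D).
  apply: bounded_closed_compact; last exact: closed_closure.
  have [M [Mr hM]] := dom_bounded D.
  (* [bounded_set] provides a bound only for radii strictly above [M], whence [M + 1]. *)
  have DM : closure D `<=` closed_ball_ Num.norm 0 (M + 1).
    rewrite (closure_id (closed_ball_ Num.norm 0 (M + 1))).1; last first.
      exact: closed_closed_ball_.
    apply: closureS => x Dx.
    by rewrite /closed_ball_ /= sub0r normrN hM// ltrDl.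
  exists (M + 1); split; first by rewrite num_real.
  move=> y My x /DM; rewrite /closed_ball_ /= sub0r normrN => /le_trans.
  by apply; exact: ltW.
have /compact_bounded[M [_ hM]] : compact (g @` closure D).
  apply: continuous_compact => //; apply: continuous_in_subspaceT => x xD.
  by apply: cg; apply/mem_set/DU/set_mem.
exists (M + 1) => x Dx; apply: hM; first by rewrite ltrDl.
by exists x => //; exact: subset_closure.
Qed.

End continuous_functions.

(** * Monotonicity of the elliptic operator *)

Section monotonicity.
Context (R : realType) (d : nat) (D : domain R d) (kappa : 'rV[R]_d -> R).
Local Notation mu := (dom_measure D).
Local Notation H := (L2D D).

Lemma measurable_test_function psi (s : seq 'I_d) : test_function D psi ->
  measurable_fun (setT : set (borel_rV R d)) (foldr (@partial R d) psi s).
Proof.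
move=> [/(@smooth_on_continuous _ _ _ _ s) cpsi _].
by apply: measurable_fun_open_continuous => //; exact: openT.
Qed.

Lemma H10_approx (u : H) (eps : R) : H10 u -> 0 < eps ->
  exists psi (p : H) (q : 'I_d -> H), [/\ test_function D psi,
    L2_fun p = psi %[ae mu], `|u - p| < eps &
    forall i, L2_fun (q i) = partial i psi %[ae mu] /\
              `|weak_partial i u - q i| < eps].
Proof.
move=> [_ +] e0 => /(_ eps e0)[psi [tpsi upsi dpsi]].
have [p pE up] := L2_approx (measurable_test_function [::] tpsi) upsi.
have /choice[q qP] i : exists qi : H, L2_fun qi = partial i psi %[ae mu] /\
    `|weak_partial i u - qi| < eps.
  have [qi qE uq] := L2_approx (measurable_test_function [:: i] tpsi) (dpsi i).
  by exists qi.
by exists psi, p, q.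
Qed.

(** With [K i] the class of the flux components, the distributional equation becomes an identity
    between inner products in [H], to which bilinearity applies. *)
Lemma op_A_test (u g : H) psi (p : H) (q K : 'I_d -> H) :
  op_A kappa u g -> test_function D psi ->
  measurable_fun (setT : set (borel_rV R d)) (kappa \_ D) ->
  L2_fun p = psi %[ae mu] ->
  (forall i, L2_fun (q i) = partial i psi %[ae mu]) ->
  (forall i, L2_fun (K i) =
     (fun x : borel_rV R d => (kappa \_ D) x * L2_fun (weak_partial i u) x)
     %[ae mu]) ->
  L2_dot g p = \sum_i L2_dot (K i) (q i).
Proof.
move=> [_ _ /(_ psi)] + tpsi mk pE qE KE => /(_ tpsi) gE.
have mpsi := measurable_test_function [::] tpsi.
rewrite (@L2_dotE _ _ _ _ _ _ (L2_fun g) psi) //; last exact: nearW.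
(* The integral over [D] becomes one over the whole space, with [kappa] continued by zero. *)
rewrite gE Rintegral_mkcond sum_L2_dot.
rewrite (_ : _ \_ _ = fun x => \sum_i ((kappa \_ D) x *
    L2_fun (weak_partial i u) x * partial i psi x)); last first.
  apply/funext => x; rewrite !patchE; case: ifP => _; last first.
    by rewrite big1// => i _; rewrite !mul0r.
  by rewrite mulr_sumr; apply: eq_bigr => i _; rewrite mulrA.
apply: ae_eq_Rintegral.
- apply: measurable_sum => i; apply: measurable_funM.
    by apply: measurable_funM => //; exact: measurable_L2_fun.
  exact: (measurable_test_function [:: i]).
- apply: measurable_sum => i.
  by apply: measurable_funM; exact: measurable_L2_fun.
have : {ae mu, forall (x : borel_rV R d) i, (kappa \_ D) x *
    L2_fun (weak_partial i u) x * partial i psi x =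
    L2_fun (K i) x * L2_fun (q i) x}.
  apply: filter_forall => i.
  by apply: filterS2 (qE i) (KE i) => x /(_ I) -> /(_ I) ->.
by move=> qKE; apply: filterS qKE => x qKE _; apply: eq_bigr => i _.
Qed.

(** If [x] were negative, [eps = - x / (B + 1)] would satisfy [eps * B < - x]. *)
Lemma ge0_by_eps (x B : R) : 0 <= B ->
  (forall eps, 0 < eps -> - (eps * B) <= x) -> 0 <= x.
Proof.
move=> B0 hx; rewrite leNgt; apply/negP => x0.
have B1 : 0 < B + 1 by rewrite ltr_wpDl.
have := hx (- x / (B + 1)); rewrite divr_gt0 ?oppr_gt0// => /(_ isT).
rewrite leNgt => /negP; apply; rewrite ltrNr mulrAC -mulrA gtr_pMr ?oppr_gt0//.
by rewrite ltr_pdivrMr// mul1r ltrDl.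
Qed.

(* [weak_partial] is a choice of weak derivative, so that its additivity in u
   would need uniqueness. It is avoided by testing each of the two equations
   with the approximants of u1 and of u2 separately. *)
Lemma op_A_monotone (M : R) (u1 u2 g1 g2 : H) :
  measurable_fun (setT : set (borel_rV R d)) (kappa \_ D) ->
  (forall x, 0 <= (kappa \_ D) x <= M) ->
  op_A kappa u1 g1 -> op_A kappa u2 g2 -> 0 <= L2_dot (g1 - g2) (u1 - u2).
Proof.
move=> mk kM A1 A2.
have kM' x : `|(kappa \_ D) x| <= M.
  by case/andP: (kM x) => k0 ?; rewrite ger0_norm.
have /choice[K1 K1E] := fun i => L2_mul_bounded (weak_partial i u1) mk kM'.
have /choice[K2 K2E] := fun i => L2_mul_bounded (weak_partial i u2) mk kM'.
pose g : H := g1 - g2; pose u : H := u1 - u2; pose K i : H := K1 i - K2 i.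
pose G i : H := weak_partial i u1 - weak_partial i u2.
(* Almost everywhere the integrand is the continued [kappa] times the square of [G i]. *)
have KG i : 0 <= L2_dot (K i) (G i).
  rewrite (@L2_dotE _ _ _ _ _ _
    (fun x : borel_rV R d => (kappa \_ D) x * L2_fun (G i) x) (L2_fun (G i))).
  - apply: Rintegral_ge0 => x _; rewrite -mulrA mulr_ge0 -?expr2 ?sqr_ge0//.
    by case/andP: (kM x).
  - by apply: measurable_funM => //; exact: measurable_L2_fun.
  - exact: measurable_L2_fun.
  - apply: filterS2 (filterI (K1E i) (K2E i)) (filterI (L2_funB (K1 i) (K2 i))
      (L2_funB (weak_partial i u1) (weak_partial i u2))).
    move=> x [] /(_ I) k1 /(_ I) k2 [] /(_ I) -> /(_ I) -> _ /=.
    by rewrite k1 k2 mulrBr.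
  - exact: nearW.
(* Replacing [u] by [p] and each [G i] by [q i] costs at most [2 * eps] in norm; Cauchy-Schwarz
   turns these errors into this factor. *)
apply: (@ge0_by_eps _ (2 * (`|g| + \sum_i `|K i|))).
  by rewrite mulr_ge0// addr_ge0// sumr_ge0.
move=> eps e0.
have [[_ u1H _] [_ u2H _]] := (A1, A2).
have [psi1 [p1 [q1 [t1 p1E up1 q1P]]]] := H10_approx u1H e0.
have [psi2 [p2 [q2 [t2 p2E up2 q2P]]]] := H10_approx u2H e0.
pose p : H := p1 - p2; pose q i : H := q1 i - q2 i.
(* Bilinearity splits this into four pairings, of each equation with each approximant. *)
have gp : L2_dot g p = \sum_i L2_dot (K i) (q i).
  rewrite L2_dotBl !L2_dotBr.
  rewrite (op_A_test A1 t1 mk p1E (fun i => (q1P i).1) K1E).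
  rewrite (op_A_test A1 t2 mk p2E (fun i => (q2P i).1) K1E).
  rewrite (op_A_test A2 t1 mk p1E (fun i => (q1P i).1) K2E).
  rewrite (op_A_test A2 t2 mk p2E (fun i => (q2P i).1) K2E).
  rewrite -!sumrB; apply: eq_bigr => i _.
  by rewrite L2_dotBl !L2_dotBr.
have up : `|u - p| <= 2 * eps.
  rewrite mulr2n mulrDl mul1r opprD addrACA -opprD.
  by rewrite (le_trans (ler_normB _ _))// lerD// ltW.
have Gq i : `|G i - q i| <= 2 * eps.
  rewrite mulr2n mulrDl mul1r opprD addrACA -opprD.
  by rewrite (le_trans (ler_normB _ _))// lerD// ltW//;
    [case: (q1P i)|case: (q2P i)].
(* The pairing is the nonnegative energy up to two approximation errors. *)
have -> : L2_dot g u = L2_dot g (u - p) + \sum_i L2_dot (K i) (G i)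
    - \sum_i L2_dot (K i) (G i - q i).
  rewrite L2_dotBr gp -addrA -sumrB.
  by under [X in _ + X]eq_bigr do rewrite L2_dotBr subKr; rewrite subrK.
have h1 : `|L2_dot g (u - p)| <= `|g| * (2 * eps).
  by rewrite (le_trans (L2_dot_le _ _))// ler_wpM2l.
have h2 : \sum_i L2_dot (K i) (G i - q i) <= (\sum_i `|K i|) * (2 * eps).
  rewrite mulr_suml; apply: ler_sum => i _.
  by rewrite (le_trans (ler_norm _))// (le_trans (L2_dot_le _ _))// ler_wpM2l.
have h3 : 0 <= \sum_i L2_dot (K i) (G i) by apply: sumr_ge0.
move: h1; rewrite ler_norml => /andP[h1 _]; lra.
Qed.
End monotonicity.

(** Continuation by zero makes measurability and bounds global, as [L2_mul_bounded] asks. Smoothness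
    of [kappa] around the closure excludes blow-up at the boundary. *)
Lemma restricted_coefficient (R : realType) (d : nat) (D : domain R d)
    (kappa : 'rV[R]_d -> R) :
  (exists U, [/\ open U, closure D `<=` U & smooth_on U kappa]) ->
  (forall x, dom_set D x -> 0 < kappa x) ->
  measurable_fun (setT : set (borel_rV R d)) (kappa \_ D) /\
  exists M, forall x, 0 <= (kappa \_ D) x <= M.
Proof.
move=> [U [oU DU sk]] k0; split.
  apply/(measurable_restrictT _ (measurable_domain D)).
  apply: measurable_fun_open_continuous; first exact: dom_open.
  move=> x /set_mem Dx; apply: (@smooth_on_continuous _ _ _ _ [::] sk).
  exact/mem_set/DU/subset_closure.
have [M hM] := smooth_on_bounded oU DU sk.
(* A point of [D] shows [0 <= M], so that [M] also bounds the value 0 taken outside. *)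
have [x0 Dx0] := dom_neq0 D.
have M0 : 0 <= M by exact: le_trans (hM _ Dx0).
exists M => x; rewrite patchE; case: ifP => [/set_mem Dx|_]; last first.
  by rewrite lexx.
by rewrite ltW ?k0//= (le_trans (ler_norm _))// hM.
Qed.

(** * Stability of one implicit step and discrete Gronwall inequality *)

(** The difference of the two equations is paired with [u - v]: the operator term has a sign,
    Cauchy-Schwarz bounds the right-hand side, and a nonzero [|u - v|] is divided out. *)
Lemma implicit_step_le d (T : measurableType d) (R : realType)
    (mu : {measure set T -> \bar R}) (tau : R)
    (u u' A F v v' B G : L2 mu) : 0 <= tau ->
  u + tau *: A = u' + tau *: F -> v + tau *: B = v' + tau *: G ->
  0 <= L2_dot (A - B) (u - v) ->
  `|u - v| <= `|u' - v'| + tau * `|F - G|.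
Proof.
move=> tau0 uE vE mon; have [->|n0] := eqVneq (u - v) 0.
  by rewrite normr0 addr_ge0// mulr_ge0.
have e0 : 0 < `|u - v| by rewrite normr_gt0.
set e := u - v in mon n0 e0 *.
have := congr1 (fun z => L2_dot z e) uE.
have := congr1 (fun z => L2_dot z e) vE.
rewrite /= !L2_dotDl !L2_dotZl => vE' uE'.
have eE : `|e| * `|e| = L2_dot u e - L2_dot v e.
  by rewrite -expr2 -L2_dotuu {1}/e L2_dotBl.
have h1 : L2_dot u' e - L2_dot v' e <= `|u' - v'| * `|e|.
  by rewrite -L2_dotBl (le_trans (ler_norm _))// L2_dot_le.
have h2 : L2_dot F e - L2_dot G e <= `|F - G| * `|e|.
  by rewrite -L2_dotBl (le_trans (ler_norm _))// L2_dot_le.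
rewrite L2_dotBl in mon.
have h3 := mulr_ge0 tau0 mon; have h4 := ler_wpM2l tau0 h2.
by rewrite -(ler_pM2r e0) eE; lra.
Qed.

(** Absorbing [x * a] leaves the factor [1 - x] on the left. One more power of [expR (2 * x)]
    compensates it, since [(1 - x) * (1 + 2 * x) >= 1] for [0 <= x <= 1 / 2]. The new term [x * b]
    fits because the power is at least 1. *)
Lemma gronwall_step (R : realType) (x a a' b S : R) (n : nat) :
  0 <= x <= 1 / 2 -> 0 <= b -> 0 <= S -> a <= a' + x * (a + b) ->
  a' <= x * expR (2 * x) ^+ n * S ->
  a <= x * expR (2 * x) ^+ n.+1 * (S + b).
Proof.
move=> /andP[x0 x1] b0 S0 ha ha'; set q := expR (2 * x) in ha' *.
have q1 : 1 + 2 * x <= q by exact: expR_ge1Dx.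
have xq : 1 <= (1 - x) * q by nra.
have qn1 : 1 <= q ^+ n by rewrite exprn_ege1//; lra.
have x1' : 0 < 1 - x by lra.
rewrite -(ler_pM2l x1').
apply: (@le_trans _ _ (x * q ^+ n * (S + b))).
  have : x * b <= x * b * q ^+ n by rewrite ler_peMr// mulr_ge0.
  lra.
rewrite exprS; set Qn := q ^+ n in qn1 *.
have h : 0 <= x * Qn * (S + b) by rewrite !mulr_ge0// ?addr_ge0//; lra.
have := ler_wpM2r h xq; lra.
Qed.

(** * Measurability of distances and Minkowski's inequality for [rms] *)

Section random_variables.
Context (R : realType) (d : nat) (D : domain R d).
Context (dOm : measure_display) (Om : measurableType dOm).
Variable P : probability Om R.
Local Notation H := (L2D D).
Implicit Types X Y : Om -> H.

(** As both ranges are finite, the preimage is a finite union of intersections of level sets. *)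
Lemma measurable_dist_simple_rv X Y : simple_rv X -> simple_rv Y ->
  measurable_fun setT (fun om => `|X om - Y om|).
Proof.
move=> [fX mX] [fY mY] _ B mB; rewrite setTI.
rewrite (_ : _ @^-1` _ = \bigcup_(h in range X) \bigcup_(k in range Y)
    if `[< B `|h - k| >] then X @^-1` [set h] `&` Y @^-1` [set k] else set0).
  apply: fin_bigcup_measurable => // h _.
  apply: fin_bigcup_measurable => // k _.
  by case: ifP => _ //; apply: measurableI.
apply/seteqP; split => om /=.
  move=> Bom; exists (X om); first by exists om.
  by exists (Y om); [exists om|case: asboolP].
by move=> [h _ [k _]]; case: asboolP => // + [-> ->].
Qed.

(** Pointwise limit of the distances of simple approximants, the error being at most the sum of the
    two approximation errors. *)
Lemma measurable_dist X Y : strongly_measurable X -> strongly_measurable Y ->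
  measurable_fun setT (fun om => `|X om - Y om|).
Proof.
move=> [S [sS SX]] [S' [sS' SY]].
apply: (@measurable_fun_cvg _ _ _ _ (fun k om => `|S k om - S' k om|)).
  by move=> k; exact: measurable_dist_simple_rv.
move=> om _; apply/cvgrPdist_le => e e0.
have SXY : `|S k om - X om| + `|S' k om - Y om| @[k --> \oo] --> (0 : R).
  by rewrite -[X in _ --> X]addr0; exact: cvgD (SX om) (SY om).
have /cvgrPdist_le /(_ e e0) := SXY; apply: filterS => k /=.
rewrite sub0r normrN; apply: le_trans.
rewrite [leRHS]ger0_norm ?addr_ge0//.
rewrite (le_trans (ler_dist_dist _ _))// opprD addrACA -opprD.
by rewrite (le_trans (ler_normB _ _))// lerD// distrC.
Qed.

Lemma rmsE X : rms P X = ('N[P]_2[EFin \o (fun om => `|X om|%R)])%E.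
Proof. by rewrite /rms unlock Lnorm2E. Qed.

Lemma rms0 : rms P (fun=> 0 : H) = 0%E.
Proof.
by rewrite /rms unlock normr0 expr0n /= integral0 sqrte0.
Qed.

(** Monotonicity of the real [L2] norm followed by Minkowski's inequality. Both act on the real
    functions [|X|] and [|Y i|], so measurability is asked of these. *)
Lemma le_rms_sum (I : Type) (r : seq I) (K : R) (X : Om -> H)
    (Y : I -> Om -> H) :
  0 <= K -> measurable_fun setT (fun om => `|X om|) ->
  (forall i, measurable_fun setT (fun om => `|Y i om|)) ->
  {ae P, forall om, `|X om| <= K * \sum_(i <- r) `|Y i om|} ->
  (rms P X <= K%:E * \sum_(i <- r) rms P (Y i))%E.
Proof.
move=> K0 mX mY XY.
have mS : measurable_fun setT (fun om => \sum_(i <- r) `|Y i om|).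
  exact: measurable_sum.
pose S om := \sum_(i <- r) `|Y i om|.
apply: (@le_trans _ _ (K%:E * 'N[P]_2[EFin \o S])%E); last first.
  apply: lee_wpmul2l; first by rewrite lee_fin.
  rewrite /S {S mS XY}; elim: r => [|i r IH].
    rewrite big_nil (_ : _ \o _ = cst 0%E) ?Lnorm0//.
    by apply/funext => om; rewrite /= big_nil.
  rewrite big_cons; apply: le_trans (leeD2l _ IH); rewrite rmsE.
  rewrite (_ : (fun om => \sum_(j <- i :: r) _) =
    ((fun om => `|Y i om|) \+ (fun om => \sum_(j <- r) `|Y j om|))%R);
    last first.
    by apply/funext => om; rewrite big_cons.
  apply: eminkowski => //; first exact: measurable_sum.
  by rewrite lee_fin ler1n.
(* Writing [K] as the root of its square moves it under the integral; the squares are then compared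
   almost surely. *)
rewrite /rms unlock Lnorm2E -[K%:E]gee0_abs ?lee_fin// -sqrte_sqr.
rewrite -sqrteM; last by rewrite -EFin_expe lee_fin sqr_ge0.
rewrite -EFin_expe -ge0_integralZl_EFin ?sqr_ge0//; last first.
- by apply/measurable_EFinP; apply: measurable_funX.
- by move=> om _; rewrite lee_fin sqr_ge0.
rewrite lee_sqrt; last first.
  by apply: integral_ge0 => om _; rewrite -EFinM lee_fin mulr_ge0 ?sqr_ge0.
apply: ae_ge0_le_integral => //.
- by apply/measurable_EFinP; apply: measurable_funX.
- by move=> om _; rewrite -EFinM lee_fin mulr_ge0 ?sqr_ge0.
- apply/measurable_EFinP; apply: measurable_funM => //.
  exact: measurable_funX.
apply: filterS XY => om XY _; rewrite -EFinM lee_fin -exprMn.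
by rewrite lerXn2r ?nnegrE// mulr_ge0// sumr_ge0.
Qed.

End random_variables.

(** * From the pathwise error bound to the root mean square estimate *)

Theorem lemma5p1 (R : realType)
  (* the domain and the operator A *)
  (d : nat) (hd : (1 <= d <= 3)%N) (D : domain R d)
  (kappa : 'rV[R]_d -> R) (kappa0 : R)
  (hkappa : exists U, [/\ open U, closure D `<=` U & smooth_on U kappa])
  (hkappa0 : 0 < kappa0) (hkappaD : forall x, dom_set D x -> kappa0 < kappa x)
  (* the nonlinearity *)
  (f : L2D D -> L2D D) (Lf : R)
  (hf : forall u v, `|f u - f v| <= Lf * `|u - v|)
  (* the noise and the initial value *)
  (dOm : measure_display) (Om : measurableType dOm) (P : probability Om R)
  (T beta : R) (hT : 0 < T) (hbeta : 0 <= beta)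
  (Q Qh : {linear L2D D -> L2D D})
  (hQ : psd_operator Q) (hQh : psd_sqrt Q Qh)
  (hHS : exists B, (forall u, op_A_power kappa ((beta - 1) / 2) (Qh u) (B u))
                   /\ finite_HS_norm B)
  (W : R -> Om -> L2D D -> R) (hW : wiener P T Q W)
  (u0 : Om -> L2D D)
  (hu0 : square_integrable_dotH P kappa beta u0)
  (* the time grid *)
  (N : nat) (hN : (0 < N)%N) (tau : R) (htau : tau = T / N%:R)
  (htauL : tau * Lf <= 1 / 2)
  (* the sequence w^n *)
  (w : nat -> Om -> L2D D)
  (hw_sq : forall n, (n <= N)%N -> square_integrable P (w n))
  (hw0 : {ae P, forall om, w 0%N om = 0})
  (hw : forall n, (1 <= n <= N)%N -> {ae P, forall om, H10 (w n om) /\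
    forall phi, H10 phi ->
      L2_dot (w n om) phi + tau * dual_A kappa (w n om) phi =
      L2_dot (w n.-1 om) phi
      + increment W (n.-1%:R * tau) (n%:R * tau) om phi})
  (* the space S_J and the sequence w_J^n *)
  (m : nat) (b : 'I_m -> L2D D) (hb : forall i, H10 (b i))
  (S_J : set (L2D D)) (hS_J : S_J = span_set b)
  (wJ : nat -> Om -> L2D D)
  (hwJ_sq : forall n, (n <= N)%N -> square_integrable P (wJ n))
  (hwJ0 : {ae P, forall om, wJ 0%N om = 0})
  (hwJ : forall n, (1 <= n <= N)%N -> {ae P, forall om, S_J (wJ n om) /\
    wJ n om + tau *: discrete_A kappa S_J (wJ n om) =
    wJ n.-1 om
    + dual_proj S_J (increment W (n.-1%:R * tau) (n%:R * tau) om)})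
  (* the sequences v^n and \bar v^n *)
  (v vbar : nat -> Om -> L2D D)
  (hv_rv : forall n, (n <= N)%N -> strongly_measurable (v n))
  (hv0 : {ae P, forall om, v 0%N om = u0 om})
  (hv : forall n, (1 <= n <= N)%N -> {ae P, forall om,
    exists2 Av, op_A kappa (v n om) Av &
    v n om + tau *: Av = v n.-1 om + tau *: f (v n om + w n om)})
  (hvbar_rv : forall n, (n <= N)%N -> strongly_measurable (vbar n))
  (hvbar0 : {ae P, forall om, vbar 0%N om = u0 om})
  (hvbar : forall n, (1 <= n <= N)%N -> {ae P, forall om,
    exists2 Av, op_A kappa (vbar n om) Av &
    vbar n om + tau *: Av = vbar n.-1 om + tau *: f (vbar n om + wJ n om)}) :
  (\big[maxe/0%E]_(1 <= n < N.+1) rms P (fun om => vbar n om - v n om)%R <=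
   (2 * Lf * T * expR (2 * Lf * T))%:E *
   \big[maxe/0%E]_(1 <= n < N.+1) rms P (fun om => wJ n om - w n om)%R)%E.
Proof.
have tau0 : 0 <= tau by rewrite htau divr_ge0// ltW.
(* A negative Lipschitz constant forces H to be trivial. *)
have [Lf0|Lf0] := ltP Lf 0.
  have H0 (g h : L2D D) : g - h = 0.
    apply/eqP; rewrite -normr_eq0 eq_le normr_ge0 andbT.
    by rewrite -(nmulr_rge0 _ Lf0) (le_trans (normr_ge0 (f g - f h))).
  rewrite (eq_bigr (fun=> 0%E)) => [|n _]; last first.
    by rewrite -[RHS](@rms0 _ _ D _ _ P); congr rms;
      apply/funext => om; exact: H0.
  rewrite [X in (_ <= _ * X)%E](eq_bigr (fun=> 0%E)) => [|n _]; last first.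
    by rewrite -[RHS](@rms0 _ _ D _ _ P); congr rms;
      apply/funext => om; exact: H0.
  have max0 n : \big[maxe/0%E]_(1 <= i < n) (0%E : \bar R) = 0%E.
    by apply: big1_idem => //; exact: maxxx.
  by rewrite max0 mule0.
pose x := tau * Lf.
have x01 : 0 <= x <= 1 / 2 by rewrite mulr_ge0.
(* The cut-off at N makes Z j measurable for every j. *)
pose Z j om := wJ (minn j N) om - w (minn j N) om.
pose S n om := \sum_(1 <= j < n.+1) `|Z j om|.
(* Pathwise bound by induction on [n]; each step intersects finitely many almost sure events. *)
have bound n : (n <= N)%N ->
    {ae P, forall om, `|vbar n om - v n om| <= x * expR (2 * x) ^+ n * S n om}.
  have [mk [M kM]] := restricted_coefficient hkappa
    (fun y Dy => lt_trans hkappa0 (hkappaD y Dy)).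
  elim: n => [_|n IHn nN].
    apply: filterS2 hv0 hvbar0 => om -> ->.
    by rewrite subrr normr0 /S big_geq// mulr0.
  have vn := hv n.+1 nN; have vbarn := hvbar n.+1 nN.
  apply: filterS3 vn vbarn (IHn (ltnW nN)) => om [A Av vE] [B Bv vbarE] IH.
  rewrite /S big_nat_recr//= {2}/Z (minn_idPl nN).
  apply: gronwall_step IH => //.
    by rewrite sumr_ge0.
  have := implicit_step_le tau0 vbarE vE (op_A_monotone mk kM Bv Av).
  (* The arguments of [f] differ by the error of the step plus [wJ - w], which the Lipschitz bound
     and the triangle inequality separate. *)
  move=> /le_trans; apply; rewrite lerD2l /x -mulrA ler_wpM2l//.
  rewrite (le_trans (hf _ _))// ler_wpM2l//.
  by rewrite opprD addrACA ler_normD.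
set B := (\big[maxe/0%E]_(1 <= n < N.+1) rms P (fun om => wJ n om - w n om)%R).
have B0 : (0 <= B)%E by exact: bigmax_ge_id.
have xN : x * N%:R = Lf * T.
  by rewrite /x htau; field; rewrite pnatr_eq0 -lt0n.
(* The default value 0 of the maximum has to be bounded too. *)
rewrite big_nat; apply: bigmax_le => [|n /andP[n1 nN]].
  by rewrite mule_ge0// lee_fin !mulr_ge0// ?expR_ge0// ltW.
have nN' : (n <= N)%N by [].
apply: le_trans (le_rms_sum _ _ _ (bound n nN')) _.
- by rewrite mulr_ge0 ?exprn_ge0 ?expR_ge0//; case/andP: x01.
- exact: measurable_dist (hvbar_rv n nN') (hv_rv n nN').
- move=> j; apply: measurable_dist.
    by case: (hwJ_sq _ (geq_minr j N)).
  by case: (hw_sq _ (geq_minr j N)).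
(* Each of the [n] summands is at most the maximum [B]. *)
apply: (@le_trans _ _ ((x * expR (2 * x) ^+ n)%:E * (n%:R%:E * B))%E).
  apply: lee_wpmul2l.
    by rewrite lee_fin mulr_ge0 ?exprn_ge0 ?expR_ge0//; case/andP: x01.
  rewrite big_nat; apply: (@le_trans _ _ (\sum_(1 <= j < n.+1) B)%E).
    rewrite [leRHS]big_nat; apply: lee_sum => j /andP[j1 jn].
    have jN : (j <= N)%N by exact: (leq_trans (jn : (j <= n)%N) nN').
    rewrite /Z (minn_idPl jN).
    apply: (@le_bigmax_seq _ _ _ _ _ j) => //.
    by rewrite mem_index_iota j1.
  by rewrite sumr_const_nat subn1 mule_natl.
rewrite muleA -EFinM lee_wpmul2r// lee_fin -expRM_natl.
have [x0 _] := andP x01.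
(* This bounds both the prefactor and the exponent, giving [Lf * T * expR (2 * Lf * T)], which lies
   below the stated constant. *)
have xn : x * n%:R <= Lf * T by rewrite -xN ler_wpM2l// ler_nat.
have xn0 : 0 <= x * n%:R by rewrite mulr_ge0.
have h1 : expR (n%:R * (2 * x)) <= expR (2 * Lf * T) by rewrite ler_expR; lra.
have h2 := expR_ge0 (n%:R * (2 * x)).
rewrite mulrAC; apply: (@le_trans _ _ (Lf * T * expR (2 * Lf * T))).
  by apply: ler_pM.
by rewrite -[2 * Lf * T]mulrA ler_wpM2r ?expR_ge0//; lra.
Qed.
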